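(* Let $\lambda<1$, $\lambda\neq0$, $q=1-\lambda>0$. Consider a $q$-exponential family $\{p_\theta(x)=\exp_q(\theta\cdot F(x)-\phi_q(\theta)):\theta\in\Theta\}$ and let $\theta_0$ be in the interior of $\Theta$. If $1-\lambda\phi_q(\theta_0)>0$ or $\theta_0\neq0$, then there exist a constant $c\in\mathbb{R}$ and a neighborhood $U$ of $\theta_0$ such that, with $\widetilde F(x)=F(x)-c\,\theta_0$, each $p_\theta$ with $\theta\in U$ can be written in the form $$p_\theta(x)=\exp_q(\vartheta\cdot\widetilde F(x))\,e^{-\varphi_\lambda(\vartheta)},$$ where $\vartheta\in\mathbb{R}^d$ is a function of $\theta$ and $\varphi_\lambda(\vartheta)$ is a real number depending only on $\vartheta$ (the normalization making the right-hand side a probability density).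
   Context: Notation: $t_+=\max\{t,0\}$, and $0^{s}=\infty$ for $s<0$. The $q$-exponential function is $\exp_q(t)=[1+(1-q)t]_+^{1/(1-q)}=[1+\lambda t]_+^{1/\lambda}\in[0,\infty]$. $q$-exponential family: let $\nu$ be a measure on a measurable space $\mathcal{X}$ and $F=(F_1,\dots,F_d):\mathcal{X}\to\mathbb{R}^d$ measurable. $\Theta$ is the set of all $\theta\in\mathbb{R}^d$ for which there is a (necessarily unique) real number $\phi_q(\theta)$ with $\int\exp_q(\theta\cdot F(x)-\phi_q(\theta))\,d\nu(x)=1$. *)

(* Defs.v *)
From HB Require Import structures.
From mathcomp Require Export all_boot all_order all_algebra.
From mathcomp Require Export all_classical all_reals all_analysis.

Set Implicit Arguments.
Unset Strict Implicit.
Unset Printing Implicit Defensive.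

Import Order.TTheory GRing.Theory Num.Theory.
Import numFieldNormedType.Exports.

Local Open Scope classical_set_scope.
Local Open Scope ring_scope.

(* The library's [powR] takes the value 0 at base 0 and negative exponent;
   here 0 ^ s = +oo for s < 0. *)
Definition epowR (R : realType) (t s : R) : \bar R :=
  if (t == 0) && (s < 0) then +oo%E else (t `^ s)%:E.

(* Meaningful only for q != 1; at q = 1 this is not the exponential. *)
Definition exp_q (R : realType) (q t : R) : \bar R :=
  epowR (Num.max (1 + (1 - q) * t) 0) (1 - q)^-1.

Definition dot (R : realType) (n : nat) (u v : 'rV[R]_n) : R :=
  \sum_(i < n) u ord0 i * v ord0 i.

Definition q_normalizer (R : realType) (dX : measure_display)
    (X : measurableType dX) (nu : {measure set X -> \bar R}) (n : nat)
    (F : X -> 'rV[R]_n) (q : R) (theta : 'rV[R]_n) : set R :=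
  [set c : R | \int[nu]_x exp_q q (dot theta (F x) - c) = 1]%E.

Definition Theta (R : realType) (dX : measure_display)
    (X : measurableType dX) (nu : {measure set X -> \bar R}) (n : nat)
    (F : X -> 'rV[R]_n) (q : R) : set 'rV[R]_n :=
  [set theta | exists c : R, q_normalizer nu F q theta c].

(* On [Theta] the normalizer is unique, so the choice made by [xget] is
   immaterial; outside [Theta] the value 0 is a dummy. *)
Definition phi_q (R : realType) (dX : measure_display)
    (X : measurableType dX) (nu : {measure set X -> \bar R}) (n : nat)
    (F : X -> 'rV[R]_n) (q : R) (theta : 'rV[R]_n) : R :=
  xget 0 (q_normalizer nu F q theta).

Definition q_density (R : realType) (dX : measure_display)
    (X : measurableType dX) (nu : {measure set X -> \bar R}) (n : nat)
    (F : X -> 'rV[R]_n) (q : R) (theta : 'rV[R]_n) (x : X) : \bar R :=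
  exp_q q (dot theta (F x) - phi_q nu F q theta).

(* Main.v *)
(** With [a theta = 1 - lam phi(theta) + lam c (theta . theta0)] and
    [vartheta = theta / a theta], one has
    [1 + lam (theta . F - phi) = a (1 + lam vartheta . (F - c theta0))], so
    [p_theta] is [exp_q (vartheta . (F - c theta0))] times [a ^ (1 / lam)];
    this factor is determined by [vartheta] through normalization. It remains
    that [a > 0] near [theta0]. At [theta0] this holds for [c = 0] if
    [1 - lam phi(theta0) > 0], and for [c = phi(theta0) / |theta0|^2] (where
    [a = 1]) if [theta0 <> 0]. It persists nearby because [phi] is continuous at [theta0]:
    as [q > 0], [exp_q] is convex, so the set of [(theta, c)] with
    [\int exp_q (theta . F - c) <= 1] is convex, and over [Theta] it is the
    epigraph of [phi]. *)
Require Import Defs.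
From mathcomp Require Import all_boot all_order all_algebra.
From mathcomp Require Import all_classical all_reals all_analysis.
From mathcomp Require Import measurable_realfun ring lra.
Import Order.TTheory GRing.Theory Num.Theory.
Import numFieldNormedType.Exports.
Local Open Scope classical_set_scope.
Local Open Scope ring_scope.

Set Implicit Arguments.
Unset Strict Implicit.

(** * The q-exponential: monotonicity, convexity and scaling *)

Lemma exp_q_lt1E (R : realType) (q t : R) : q < 1 ->
  exp_q q t = (Num.max (1 + (1 - q) * t) 0 `^ (1 - q)^-1)%:E.
Proof.
by move=> q1; rewrite /exp_q /epowR [_ < 0]ltNge invr_ge0 subr_ge0 ltW// andbF.
Qed.

Lemma exp_q_gt1E (R : realType) (q t : R) : 1 < q ->
  exp_q q t = if 0 < 1 + (1 - q) * t
              then ((1 + (1 - q) * t) `^ (1 - q)^-1)%:E else +oo%E.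
Proof.
move=> q1; rewrite /exp_q /epowR invr_lt0 subr_lt0 q1 andbT.
by case: ltP => [t0|_]; rewrite ?eqxx// gt_eqF.
Qed.

Lemma exp_q_ge0 (R : realType) (q t : R) : (0 <= exp_q q t)%E.
Proof. by rewrite /exp_q /epowR; case: ifP => // _; rewrite lee_fin powR_ge0. Qed.

Lemma measurable_exp_q (R : realType) (q : R) :
  measurable_fun setT (exp_q q).
Proof.
have mm : measurable_fun setT (fun t : R => Num.max (1 + (1 - q) * t) 0).
  apply: measurable_maxr; last exact: measurable_cst.
  by apply: measurable_funD => //; apply: measurable_funM.
apply: (@measurable_fun_ifT _ _ _ _ _ _
  (fun t : R => (Num.max (1 + (1 - q) * t) 0 == 0) && ((1 - q)^-1 < 0))).
- apply: measurable_and; first exact: measurable_fun_eqr.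
  exact: measurable_cst.
- exact: measurable_cst.
- apply/measurable_EFinP.
  by apply: (measurableT_comp (measurable_powR _) mm).
Qed.

(** For [q < 1] truncation makes [exp_q] constantly 0 on a half-line, and for [q > 1] it is
    constantly [+oo] on one. The two conditions on the value at [s] put [s] outside that half-line,
    where the base is positive and the power is strictly monotone. *)
Lemma exp_q_lt (R : realType) (q s t : R) : q != 1 -> s < t ->
  (0 < exp_q q s)%E -> (exp_q q s < +oo)%E -> (exp_q q s < exp_q q t)%E.
Proof.
move=> qN1 st; have [q1|q1|q1] := ltgtP q 1; last by rewrite q1 eqxx in qN1.
- rewrite !exp_q_lt1E// !lte_fin => s0 _.
  have l0 : 0 < 1 - q by rewrite subr_gt0.
  have {}s0 : 0 < Num.max (1 + (1 - q) * s) 0.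
    by apply: gt0_powR s0; rewrite ?invr_gt0// le_max lexx orbT.
  apply: gt0_ltr_powR; rewrite ?invr_gt0// ?nnegrE ?le_max ?lexx ?orbT//.
  move: s0; rewrite lt_max ltxx orbF => s0.
  have lst : 1 + (1 - q) * s < 1 + (1 - q) * t by rewrite ltrD2l ltr_pM2l.
  by rewrite !max_l// ltW// (lt_trans s0).
- rewrite !exp_q_gt1E// => _.
  case: ifPn => [s0|]; last by rewrite ltxx.
  move=> _; case: ifPn => [t0|]; last by rewrite ltry.
  rewrite lte_fin /powR !gt_eqF// ltr_expR.
  rewrite ltr_nM2l ?invr_lt0 ?subr_lt0// ltr_ln ?posrE//.
  by rewrite ltrD2l ltr_nM2l ?subr_lt0.
Qed.

Lemma exp_q_le (R : realType) (q s t : R) : q != 1 -> s <= t ->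
  (exp_q q s <= exp_q q t)%E.
Proof.
move=> qN1; rewrite le_eqVlt => /predU1P[->//|st].
have [->|s0] := eqVneq (exp_q q s) 0%E; first exact: exp_q_ge0.
have [soo|soo] := eqVneq (exp_q q s) +oo%E; last first.
  by apply/ltW/exp_q_lt; rewrite ?ltey// lt0e s0 exp_q_ge0.
move: soo; have [q1|q1|q1] := ltgtP q 1; last by rewrite q1 eqxx in qN1.
  by rewrite exp_q_lt1E.
rewrite !exp_q_gt1E//; case: ifPn => // sN _.
by rewrite ifF ?leey//; apply: contraNF sN => t0; nra.
Qed.

(** For [q < 1], positivity of [q] gives an exponent [1 / (1 - q) >= 1], so a convex increasing
    power is applied to the convex function [max(., 0)]. For [q > 1] the exponent is negative: where
    the base is positive its power is log-convex, since [ln] is concave, and elsewhere the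
    right-hand side is [+oo]. *)
Lemma exp_q_convex (R : realType) (q w s t : R) : 0 < q -> q != 1 ->
  0 < w < 1 ->
  (exp_q q (w * s + (1 - w) * t) <=
     w%:E * exp_q q s + (1 - w)%:E * exp_q q t)%E.
Proof.
move=> q0 qN1 /andP[w0 w1].
have w1' : 0 < 1 - w by rewrite subr_gt0.
pose p : {i01 R} := Itv01 (ltW w0) (ltW w1).
set l := 1 - q.
have lE : 1 + l * (w * s + (1 - w) * t) =
    w * (1 + l * s) + (1 - w) * (1 + l * t) by ring.
have [q1|q1|q1] := ltgtP q 1; last by rewrite q1 eqxx in qN1.
- rewrite !exp_q_lt1E// -!EFinM -EFinD lee_fin -/l lE.
  have l0 : 0 < l by rewrite subr_gt0.
  set a := 1 + l * s; set b := 1 + l * t.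
  have ma (x : R) : x <= Num.max x 0 by rewrite le_max lexx.
  have m0 (x : R) : 0 <= Num.max x 0 by rewrite le_max lexx orbT.
  apply: (@le_trans _ _ ((w * Num.max a 0 + (1 - w) * Num.max b 0) `^ l^-1)).
    apply: ge0_ler_powR; rewrite ?invr_ge0 ?nnegrE ?(ltW l0)//.
      by rewrite addr_ge0// mulr_ge0// ltW.
    rewrite ge_max; apply/andP; split; last by rewrite addr_ge0// mulr_ge0// ltW.
    by rewrite lerD// ler_wpM2l// ltW.
  have l1 : 1 <= l^-1 by rewrite invf_ge1// /l gerBl ltW.
  have := convex_powR l1 p (x := Num.max a 0) (y := Num.max b 0).
  by rewrite !inE/= !in_itv/= !m0 !convRE; apply.
- rewrite !exp_q_gt1E// -/l lE.
  have l0 : l < 0 by rewrite subr_lt0.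
  set a := 1 + l * s; set b := 1 + l * t.
  have pos (x : R) : (0 <= if (0 < x)%R then (x `^ l^-1)%:E else +oo)%E.
    by case: ifP => // _; rewrite lee_fin powR_ge0.
  have [a0|a0] := ltP 0 a; last first.
    rewrite gt0_muley ?lte_fin// addye ?leey// gt_eqF//.
    by rewrite (lt_le_trans ltNy0)// mule_ge0 ?pos// lee_fin ltW.
  have [b0|b0] := ltP 0 b; last by rewrite gt0_muley ?lte_fin// addey ?leey.
  have ab0 : 0 < w * a + (1 - w) * b by rewrite addr_gt0// mulr_gt0.
  rewrite ab0 -!EFinM -EFinD lee_fin /powR !gt_eqF//.
  have := concave_ln p a0 b0; rewrite !convRE => ln_ab.
  apply: (@le_trans _ _ (expR (w * (l^-1 * ln a) + (1 - w) * (l^-1 * ln b)))).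
    rewrite ler_expR !(mulrCA _ l^-1) -mulrDr.
    by rewrite ler_nM2l ?invr_lt0.
  by have := convex_expR p (l^-1 * ln a) (l^-1 * ln b); rewrite !convRE.
Qed.

(** Positive homogeneity of the truncated power: a factor [a > 0] commutes with truncation at 0, and
    a product with it is [+oo] exactly when the other factor is. This extracts the factor
    [a ^ (1 / lam)] from the density. *)
Lemma exp_q_scale (R : realType) (q a s t : R) : 0 < a ->
  1 + (1 - q) * s = a * (1 + (1 - q) * t) ->
  exp_q q s = (exp_q q t * (a `^ (1 - q)^-1)%:E)%E.
Proof.
move=> a0 st; rewrite /exp_q /epowR st -[X in Num.max _ X](mulr0 a).
rewrite -maxr_pMr ?(ltW a0)// mulf_eq0 (gt_eqF a0)/=.
case: ifPn => _; first by rewrite gt0_mulye// lte_fin powR_gt0.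
by rewrite mulrC powRM ?(ltW a0)// le_max lexx orbT.
Qed.

(** * Total mass, its sublevel sets, and continuity of the normalizer *)

Section mass.
Context (R : realType) (dX : measure_display) (X : measurableType dX)
  (nu : {measure set X -> \bar R}) (n : nat) (F : X -> 'rV[R]_n)
  (mF : forall i : 'I_n, measurable_fun [set: X] (fun x => F x ord0 i))
  (q : R) (q_gt0 : 0 < q) (q_neq1 : q != 1).
Implicit Types (theta : 'rV[R]_n) (c d : R).

Definition mass theta c : \bar R :=
  (\int[nu]_x exp_q q (dot theta (F x) - c))%E.

Lemma measurable_integrand theta c :
  measurable_fun setT (fun x => exp_q q (dot theta (F x) - c)).
Proof.
have mdot : measurable_fun setT (fun x => dot theta (F x) - c).
  apply: measurable_funB => //.
  by apply: measurable_sum => i; apply: measurable_funM.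
exact: (measurableT_comp (measurable_exp_q q) mdot).
Qed.

Lemma mass_le theta c d : c <= d -> (mass theta d <= mass theta c)%E.
Proof.
move=> cd; apply: ge0_le_integral => //.
- by move=> x _; exact: exp_q_ge0.
- exact: measurable_integrand.
- exact: measurable_integrand.
- by move=> x _; apply: exp_q_le; rewrite ?lerD2l ?lerN2.
Qed.

(* The sublevel set [mass <= 1] is the epigraph of the normalizer; unlike
   [Theta], it is convex. *)
Lemma mass_convex w theta theta' c d : 0 < w < 1 ->
  (mass theta c <= 1)%E -> (mass theta' d <= 1)%E ->
  (mass (w *: theta + (1 - w) *: theta')
     (w * c + (1 - w) * d)%R <= 1)%E.
Proof.
move=> w01 m1 m2; have /andP[/ltW w0 /ltW w1] := w01.
have w1' : 0 <= 1 - w by rewrite subr_ge0.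
have mZ v e (k : R) :
    measurable_fun setT (fun x => k%:E * exp_q q (dot v (F x) - e))%E.
  by apply: emeasurable_funM => //; exact: measurable_integrand.
have Z0 v e (k : R) x : 0 <= k -> (0 <= k%:E * exp_q q (dot v (F x) - e))%E.
  by move=> k0; rewrite mule_ge0 ?exp_q_ge0.
apply: (@le_trans _ _ (\int[nu]_x (w%:E * exp_q q (dot theta (F x) - c) +
   (1 - w)%:E * exp_q q (dot theta' (F x) - d)))%E).
  apply: ge0_le_integral => //.
  - by move=> x _; exact: exp_q_ge0.
  - exact: measurable_integrand.
  - exact: emeasurable_funD.
  - move=> x _; apply: le_trans (exp_q_convex _ _ _ _ w01) => //.
    rewrite (_ : dot _ _ - _ = w * (dot theta (F x) - c) +
      (1 - w) * (dot theta' (F x) - d))//.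
    suff -> : dot (w *: theta + (1 - w) *: theta') (F x) =
      w * dot theta (F x) + (1 - w) * dot theta' (F x) by ring.
    rewrite /dot !mulr_sumr -big_split/=; apply: eq_bigr => i _.
    by rewrite !mxE mulrDl !mulrA.
rewrite ge0_integralD//; [|by move=> x _; exact: Z0..].
rewrite !ge0_integralZl//; try exact: measurable_integrand;
  try by move=> x _; exact: exp_q_ge0.
rewrite -/(mass _ _) -/(mass _ _).
have -> : (1 = w%:E * 1 + (1 - w)%:E * 1 :> \bar R)%E.
  by rewrite !mule1 -EFinD addrC subrK.
exact: (leeD (lee_wpmul2l (w0 : (0 <= w%:E)%E) m1)
  (lee_wpmul2l (w1' : (0 <= (1 - w)%:E)%E) m2)).
Qed.

(** If [c < d], the integrand at [c] dominates the one at [d], whose integral is 1, so the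
    difference integrates to 0 and the two agree almost everywhere. The integrand at [d] is finite
    almost everywhere, and by strict monotonicity agreement there forces the value 0, contradicting
    mass 1. *)
Lemma normalizer_le theta c d :
  (mass theta c <= 1)%E -> mass theta d = 1%E -> d <= c.
Proof.
move=> mc md; rewrite leNgt; apply/negP => cd.
pose f x := exp_q q (dot theta (F x) - d).
pose g x := exp_q q (dot theta (F x) - c).
have st x : dot theta (F x) - d < dot theta (F x) - c.
  by rewrite ltrD2l ltrN2.
have f0 x : (0 <= f x)%E by exact: exp_q_ge0.
have mf : measurable_fun setT f by exact: measurable_integrand.
have mg : measurable_fun setT g by exact: measurable_integrand.
(* The maximum with 0 matters where both integrands are [+oo]: it keeps [p] nonnegative, and
   [g = f + p] still holds there. *)
pose p x := maxe (g x - f x)%E 0%E.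
have p0 x : (0 <= p x)%E by rewrite le_max lexx orbT.
have mp : measurable_fun setT p.
  by apply: measurable_maxe; [exact: emeasurable_funB|exact: measurable_cst].
have gE x : g x = (f x + p x)%E.
  have fg : (f x <= g x)%E by apply: exp_q_le => //; exact: ltW.
  have [foo|foo] := eqVneq (f x) +oo%E.
    move: fg; rewrite foo leye_eq => /eqP ->.
    by rewrite addye// gt_eqF// (lt_le_trans ltNy0).
  have ff : f x \is a fin_num by rewrite ge0_fin_numE// ltey.
  by rewrite /p max_l ?sube_ge0 ?ff// addeC subeK.
have Ip : (\int[nu]_x p x = 0)%E.
  apply/eqP; rewrite eq_le integral_ge0 ?andbT//.
  move: mc; rewrite /mass (eq_integral (fun x => f x + p x)%E); last first.
    by move=> x _; rewrite -gE.
  rewrite ge0_integralD// [X in (X + _)%E]md.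
  by rewrite -[X in (_ <= X)%E -> _]adde0 leeD2lE.
have f_fin : {ae nu, forall x, setT x -> f x \is a fin_num}.
  apply: integrable_ae => //; apply/integrableP; split => //.
  rewrite (eq_integral f) => [|x _]; last by rewrite gee0_abs.
  by rewrite [X in (X < _)%E]md ltry.
have p_ae : ae_eq nu setT p (cst 0%E).
  apply/ae_eq_integral_abs => //.
  by rewrite (eq_integral p) => [|x _]//; rewrite gee0_abs.
have : (\int[nu]_x f x = \int[nu]_x cst 0 x)%E.
  apply: ge0_ae_eq_integral => //.
  move: p_ae f_fin; apply: filterS2 => x px fx _.
  apply/eqP; apply/negPn/negP => fN0.
  have fg : (f x < g x)%E.
    apply: exp_q_lt => //; first by rewrite -/(f x) lt0e fN0 f0.
    by move: (fx I); rewrite ge0_fin_numE ?f0.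
  have := px I; rewrite /p/= => /eqP; apply/negP.
  by rewrite gt_eqF// lt_max sube_gt0 fg.
rewrite integral0 [LHS]md => /eqP; by rewrite onee_eq0.
Qed.

(** The point [theta + s *: v] is a convex combination of [theta] and a fixed further point of
    [Theta] on the ray, with normalizer [d]. With weight [w] on the latter the level is
    [c + w * (d - c)], at most [c + eps] for small [w]. *)
Lemma mass_ray theta c (v : 'rV[R]_n) (eps : R) :
  (mass theta c <= 1)%E -> (\forall th \near theta, Theta nu F q th) ->
  0 < eps -> (forall j, `|v ord0 j| <= 1) ->
  exists2 delta : R, 0 < delta & forall s, 0 <= s < delta ->
    (mass (theta + s *: v) (c + eps)%R <= 1)%E.
Proof.
move=> mc nTh eps0 v1.
have [r /= r0 rTh] := (nbhs_ballP theta _).1 nTh.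
have r20 : 0 < r / 2 by lra.
have [|d md] := rTh (theta + (r / 2) *: v).
  split=> // i j; rewrite ord1 /ball/= !mxE opprD addNKr normrN normrM.
  by have := v1 j; rewrite (gtr0_norm r20); nra.
have [K k0 dK] : exists2 K, 0 < K & d - c <= K.
  by exists (`|d - c| + 1); [rewrite ltr_pwDr|rewrite ler_wpDr// ler_norm].
(* The bound [m] on the weight: [m <= 1] keeps the combination convex, and [m * K <= eps] controls
   the rise of the level. *)
have [m m0 [m1 mK]] : exists2 m, 0 < m & m <= 1 /\ m * K <= eps.
  exists (Num.min 1 (eps / K)); first by rewrite lt_min ltr01 divr_gt0.
  by split; [|rewrite -ler_pdivlMr//]; rewrite ge_min lexx ?orbT.
exists (r / 2 * m); first by rewrite mulr_gt0.
move=> s /andP[]; rewrite le_eqVlt => /predU1P[<- _|s0 sm].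
  rewrite scale0r addr0; apply: le_trans mc; apply: mass_le.
  by rewrite lerDl ltW.
have [w sE] : exists w, s = w * (r / 2).
  by exists (s / (r / 2)); rewrite divfK ?gt_eqF.
have w0 : 0 < w by move: s0; rewrite sE pmulr_lgt0.
have wm : w < m by move: sm; rewrite sE [X in _ < X]mulrC ltr_pM2r.
have md1 : (mass (theta + (r / 2) *: v) d <= 1)%E by rewrite [mass _ _]md.
have w01 : 0 < w < 1 by rewrite w0 (lt_le_trans wm).
have := mass_convex w01 md1 mc.
rewrite (_ : w *: _ + _ = theta + s *: v); last first.
  rewrite scalerDr scalerBl scale1r scalerA -sE.
  by rewrite addrC addrA subrK.
apply: le_trans; apply: mass_le.
have : w * (d - c) <= m * K by nra.
lra.
Qed.

(** Induction over the coordinates: adding direction [i] yields the midpoint of a point on the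
    [i]-th axis through [theta] and a point displaced along the earlier directions, both with
    doubled coordinates. Both have level [c + eps], so the bound does not grow with the number of
    steps. *)
Lemma mass_near theta c (eps : R) :
  (mass theta c <= 1)%E -> (\forall th \near theta, Theta nu F q th) ->
  0 < eps ->
  exists2 delta : R, 0 < delta & forall h : 'rV[R]_n,
    (forall i, `|h ord0 i| < delta) ->
    (mass (theta + h) (c + eps)%R <= 1)%E.
Proof.
move=> mc nTh eps0.
suff [delta delta0 H] : exists2 delta : R, 0 < delta & forall h : 'rV[R]_n,
    (forall i, `|h ord0 i| < delta) ->
    (mass (theta + \sum_(i < n) h ord0 i *: delta_mx ord0 i)
       (c + eps)%R <= 1)%E.
  have hE (h : 'rV[R]_n) : h = \sum_(i < n) h ord0 i *: delta_mx ord0 i.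
    by rewrite [LHS]matrix_sum_delta big_ord1.
  by exists delta; [exact: delta0|move=> h /H; rewrite -(hE h)].
elim: (index_enum _) => [|i s [d1 d10 IH]].
  exists 1; [exact: ltr01|move=> h _; rewrite big_nil addr0].
  by apply: le_trans mc; apply: mass_le; rewrite lerDl ltW.
(* [mass_ray] covers only [s >= 0], so it is applied to both signs of the basis vector. *)
have e1 j : `|(delta_mx ord0 i : 'rV[R]_n) ord0 j| <= 1.
  by rewrite mxE normr_nat lern1 leq_b1.
have Ne1 j : `|(- delta_mx ord0 i : 'rV[R]_n) ord0 j| <= 1.
  by rewrite mxE normrN.
have [d2 d20 H2] := mass_ray mc nTh eps0 e1.
have [d3 d30 H3] := mass_ray mc nTh eps0 Ne1.
have half0 : 0 < (2^-1 : R) < 1 by lra.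
exists (2^-1 * Num.min d1 (Num.min d2 d3)).
  by rewrite mulr_gt0// !lt_min d10 d20.
move=> h hd.
have h2 j : `|(2 *: h) ord0 j| < Num.min d1 (Num.min d2 d3).
  by rewrite mxE normrM gtr0_norm// mulrC -ltr_pdivlMr// mulrC.
have m1 : (mass (theta + \sum_(j <- s) (2 *: h) ord0 j *: delta_mx ord0 j)
   (c + eps)%R <= 1)%E.
  by apply: IH => j; apply: lt_le_trans (h2 j) _; rewrite ge_min lexx.
have m2 : (mass (theta + (2 *: h) ord0 i *: delta_mx ord0 i)
   (c + eps)%R <= 1)%E.
  have := h2 i; rewrite !lt_min => /and3P[_ hi2 hi3].
  have [hi|hi] := leP 0 ((2 *: h) ord0 i).
    by apply: H2; rewrite hi -[X in X < _]ger0_norm.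
  rewrite -[X in theta + X]opprK -scaleNr -scalerN.
  by apply: H3; rewrite oppr_ge0 ltW//= -[X in X < _]ltr0_norm.
have cE : 2^-1 * (c + eps) + (1 - 2^-1) * (c + eps) = c + eps by ring.
have half : 1 - 2^-1 = 2^-1 :> R by lra.
have twiceK j : 2^-1 *: ((2 *: h) ord0 j *: (delta_mx ord0 j : 'rV[R]_n)) =
    h ord0 j *: delta_mx ord0 j.
  by rewrite mxE !scalerA mulKf.
have hE : 2^-1 *: (theta + (2 *: h) ord0 i *: delta_mx ord0 i) +
    (1 - 2^-1) *: (theta + \sum_(j <- s) (2 *: h) ord0 j *: delta_mx ord0 j) =
    theta + \sum_(j <- i :: s) h ord0 j *: delta_mx ord0 j.
  rewrite big_cons !scalerDr addrACA -scalerDl addrC [_ + (1 - _)]addrC subrK.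
  rewrite scale1r addrC half twiceK scaler_sumr.
  by congr (_ + (_ + _)); apply: eq_bigr => j _; exact: twiceK.
by have := mass_convex half0 m2 m1; rewrite cE hE.
Qed.

Lemma mass_phi_q theta : Theta nu F q theta ->
  mass theta (phi_q nu F q theta) = 1%E.
Proof. by move=> h; exact: (xgetPex 0 h). Qed.

(* The lower estimate comes from the upper one at the reflected point
   [2 theta0 - theta], by convexity. *)
Lemma phi_q_near theta0 (eps : R) :
  (\forall th \near theta0, Theta nu F q th) -> 0 < eps ->
  exists2 delta : R, 0 < delta & forall th : 'rV[R]_n,
    (forall i, `|th ord0 i - theta0 ord0 i| < delta) ->
    Theta nu F q th /\ `|phi_q nu F q th - phi_q nu F q theta0| <= eps.
Proof.
have half0 : 0 < (2^-1 : R) < 1 by lra.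
(* To be used with [a] the normalizer at [th], [b] the one at [theta0], and [e = eps]; the second
   premise is the midpoint inequality. *)
have close (a b e : R) : a <= b + e ->
    b <= 2^-1 * a + (1 - 2^-1) * (b + e) -> `|a - b| <= e.
  by move=> ab ba; rewrite ler_norml; apply/andP; split; lra.
move=> nTh eps0; have Th0 : Theta nu F q theta0 by exact: nbhs_singleton.
set phi := phi_q nu F q.
have m0 : (mass theta0 (phi theta0) <= 1)%E by rewrite mass_phi_q.
have [d d0 H] := mass_near m0 nTh eps0.
have [r /= r0 rTh] := (nbhs_ballP theta0 _).1 nTh.
exists (Num.min d r); first by rewrite lt_min d0 r0.
move=> th thP.
have thd i : `|th ord0 i - theta0 ord0 i| < d.
  by have := thP i; rewrite lt_min => /andP[].
have Th : Theta nu F q th.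
  apply: rTh; split=> // i j; rewrite ord1 /ball/= distrC.
  by have := thP j; rewrite lt_min => /andP[].
split=> //.
have up : phi th <= phi theta0 + eps.
  have thE : theta0 + (th - theta0) = th by rewrite addrC subrK.
  apply: (@normalizer_le th); last exact: mass_phi_q.
  by rewrite -{1}thE; apply: H => i; rewrite !mxE.
have mr : (mass (theta0 + (theta0 - th)) (phi theta0 + eps)%R <= 1)%E.
  by apply: H => i; rewrite !mxE distrC.
have mth : (mass th (phi th) <= 1)%E by rewrite mass_phi_q.
have hE : 2^-1 *: th + (1 - 2^-1) *: (theta0 + (theta0 - th)) = theta0.
  by apply/matrixP => i j; rewrite !mxE; field.
have := mass_convex half0 mth mr; rewrite hE.
move=> /normalizer_le/(_ (mass_phi_q Th0)); exact: close.
Qed.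

End mass.

(** * Elementary facts on the dot product *)

Lemma dot_near (R : realType) (n : nat) (u v : 'rV[R]_n) (eps : R) : 0 < eps ->
  exists2 delta : R, 0 < delta & forall w : 'rV[R]_n,
    (forall i, `|w ord0 i - u ord0 i| < delta) ->
    `|dot w v - dot u v| <= eps.
Proof.
move=> eps0; have [S S0 SE] : exists2 S, 0 <= S & S = \sum_i `|v ord0 i|.
  by exists (\sum_i `|v ord0 i|) => //; exact: sumr_ge0.
(* Adding 1 keeps the denominator positive when [v = 0]. *)
exists (eps / (S + 1)); first by rewrite divr_gt0// ltr_wpDl.
move=> w wu; rewrite /dot -sumrB.
apply: le_trans (ler_norm_sum _ _ _) _.
apply: (@le_trans _ _ (\sum_i eps / (S + 1) * `|v ord0 i|)).
  apply: ler_sum => i _; rewrite -mulrBl normrM ler_wpM2r// ltW//.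
rewrite -mulr_sumr -SE mulrAC ler_pdivrMr ?ltr_wpDl//.
by rewrite ler_wpM2l ?(ltW eps0)// lerDl.
Qed.

Lemma dot_gt0 (R : realType) (n : nat) (u : 'rV[R]_n) : u <> 0 -> 0 < dot u u.
Proof.
move=> u0; rewrite lt0r; apply/andP; split; last first.
  by apply: sumr_ge0 => i _; rewrite -expr2 sqr_ge0.
apply: contra_notN u0 => /eqP uu0; apply/rowP => i; rewrite mxE.
have sq0 j : true -> 0 <= u ord0 j * u ord0 j by rewrite -expr2 sqr_ge0.
have /eqP : u ord0 i * u ord0 i = 0 by exact: (psumr_eq0P sq0 uu0).
by rewrite mulf_eq0 orbb => /eqP.
Qed.

Lemma dotZB (R : realType) (n : nat) (k c : R) (u v w : 'rV[R]_n) :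
  dot (k *: u) (v - c *: w) = k * (dot u v - c * dot u w).
Proof.
rewrite /dot [c * _]mulr_sumr -sumrB mulr_sumr; apply: eq_bigr => i _.
by rewrite !mxE; ring.
Qed.

(** * The reparametrized family near [theta0] *)

Unset Implicit Arguments.
Set Strict Implicit.

Theorem proposition3p8 (R : realType) (dX : measure_display)
    (X : measurableType dX) (nu : {measure set X -> \bar R}) (n : nat)
    (F : X -> 'rV[R]_n)
    (mF : forall i : 'I_n, measurable_fun [set: X] (fun x => F x ord0 i))
    (lam q : R) (lam_lt1 : lam < 1) (lam_neq0 : lam != 0)
    (qE : q = 1 - lam) (q_gt0 : 0 < q)
    (theta0 : 'rV[R]_n) (theta0_int : interior (Theta nu F q) theta0)
    (h : 0 < 1 - lam * phi_q nu F q theta0 \/ theta0 <> 0) :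
  exists (c : R) (U : set 'rV[R]_n),
    [/\ nbhs theta0 U, U `<=` Theta nu F q &
      let Ft := fun x : X => F x - c *: theta0 in
      exists (vartheta : 'rV[R]_n -> 'rV[R]_n) (varphi : 'rV[R]_n -> R),
        forall theta : 'rV[R]_n, U theta ->
          let density := fun x : X =>
            (exp_q q (dot (vartheta theta) (Ft x)) *
             (expR (- varphi (vartheta theta)))%:E)%E in
          (forall x : X, q_density nu F q theta x = density x) /\
          (\int[nu]_x density x = 1)%E].
Proof.
have perturb (A x y : R) : 0 < A -> x <= A / 4 -> - (A / 4) <= y ->
    0 < A - x + y by lra.
have lE : 1 - q = lam by rewrite qE opprB addrC subrK.
have q_neq1 : q != 1 by rewrite -subr_eq0 -opprB lE oppr_eq0.
set phi := phi_q nu F q.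
pose a (c : R) th := 1 - lam * phi th + lam * (c * dot th theta0).
have [c a0] : exists c, 0 < a c theta0.
  case: h => [h|/dot_gt0 d0]; first by exists 0; rewrite /a mul0r mulr0 addr0.
  exists (phi theta0 / dot theta0 theta0).
  by rewrite /a divfK ?gt_eqF// subrK.
have [k k0 kE] : exists2 k : R, 0 < k & k = `|lam|.
  by exists `|lam|; rewrite ?normr_gt0.
have a4 : 0 < a c theta0 / 4 / k by rewrite !divr_gt0.
have [d1 d10 H1] := phi_q_near mF q_gt0 q_neq1 theta0_int a4.
(* Each of the two varying terms of [a c th] may move by a quarter of [a c theta0], which leaves at
   least half of it. Here [|c| + 1] replaces [|c|] because [c] may be 0. *)
have a4c : 0 < a c theta0 / 4 / (k * (`|c| + 1)).
  by rewrite !divr_gt0// mulr_gt0// ltr_pwDr.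
have [d2 d20 H2] := dot_near theta0 theta0 a4c.
have a_gt0 (th : 'rV[R]_n) : (forall i, `|th ord0 i - theta0 ord0 i| < d1) ->
    (forall i, `|th ord0 i - theta0 ord0 i| < d2) -> 0 < a c th.
  move=> /H1[_ p1] /H2 p2.
  have aE : a c th = a c theta0 - lam * (phi th - phi theta0) +
      lam * (c * (dot th theta0 - dot theta0 theta0)).
    rewrite /a.
    by move: (phi th) (phi theta0) (dot th theta0) (dot theta0 _) => x y z t; ring.
  have l1 : `|lam * (phi th - phi theta0)| <= a c theta0 / 4.
    by rewrite normrM -kE mulrC -ler_pdivlMr.
  have l2 : `|lam * (c * (dot th theta0 - dot theta0 theta0))| <=
      a c theta0 / 4.
    move: p2; rewrite ler_pdivlMr => [|]; last by rewrite mulr_gt0// ltr_pwDr.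
    apply: le_trans; rewrite !normrM -kE mulrA [X in _ <= X]mulrC.
    by rewrite ler_wpM2r// ler_wpM2l ?(ltW k0)// lerDl.
  move: l1 l2; rewrite !ler_norml => /andP[_ l1] /andP[l2 _].
  by rewrite aE; exact: perturb.
exists c, [set th | forall i, `|th ord0 i - theta0 ord0 i| < Num.min d1 d2].
split.
- apply/nbhs_ballP; exists (Num.min d1 d2); first by rewrite /= lt_min d10 d20.
  by move=> th [_ thP] i; rewrite distrC; exact: thP.
- move=> th thP; apply: (H1 th _).1 => i.
  by have := thP i; rewrite lt_min => /andP[].
move=> Ft; pose K v := (\int[nu]_x exp_q q (dot v (Ft x)))%E.
(* Defining [varphi] through the integral [K v] makes it a function of [v] alone, whereas the factor
   [a c th ^ (1 / lam)] refers to [th]; normalization shows below that the two agree. *)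
exists (fun th => (a c th)^-1 *: th), (fun v => ln (fine (K v))).
move=> th thP density.
have th1 i : `|th ord0 i - theta0 ord0 i| < d1.
  by have := thP i; rewrite lt_min => /andP[].
have th2 i : `|th ord0 i - theta0 ord0 i| < d2.
  by have := thP i; rewrite lt_min => /andP[].
have b0 : 0 < a c th by exact: a_gt0.
have [Th _] := H1 th th1.
set v := (a c th)^-1 *: th in density *.
set p := a c th `^ lam^-1.
have p0 : 0 < p by exact: powR_gt0.
have pE x : q_density nu F q th x = (exp_q q (dot v (Ft x)) * p%:E)%E.
  rewrite /q_density /p -lE; apply: exp_q_scale => //.
  rewrite lE /v /Ft dotZB [RHS]mulrDr mulr1 [lam * (_^-1 * _)]mulrCA mulVKf ?gt_eqF//.
  by rewrite /a -/phi; move: (phi th) (dot th (F x)) (dot th theta0) => y z t; ring.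
have mFt i : measurable_fun [set: X] (fun x => Ft x ord0 i).
  apply: (eq_measurable_fun (fun x => F x ord0 i - c * theta0 ord0 i)).
    by move=> x _; rewrite /Ft !mxE.
  by apply: measurable_funB => //; exact: mF.
have mK : measurable_fun [set: X] (fun x => exp_q q (dot v (Ft x))).
  have := measurable_integrand mFt q v 0.
  by under [X in measurable_fun _ X -> _]eq_fun do rewrite subr0.
(* The left side is the integral of [p_theta]. As [p] is positive and finite, this rules out
   infinite [K v], so [fine] loses nothing. *)
have Kp : (K v * p%:E = 1)%E.
  rewrite /K -ge0_integralZr//; last by rewrite lee_fin ltW.
  - rewrite -(mass_phi_q Th); apply: eq_integral => x _; exact/esym/pE.
  - by move=> x _; exact: exp_q_ge0.
have varphiE : expR (- ln (fine (K v))) = p.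
  move: Kp; case: (K v) => [r| |] /=.
  - rewrite -EFinM => -[rp].
    have r0 : 0 < r by rewrite -(pmulr_lgt0 _ p0) rp.
    by rewrite expRN lnK ?posrE// -[RHS](mulKf (lt0r_neq0 r0)) rp mulr1.
  - by rewrite gt0_mulye ?lte_fin.
  - by rewrite gt0_mulNye ?lte_fin.
have dE x : q_density nu F q th x = density x by rewrite pE /density varphiE.
split=> //; rewrite -(mass_phi_q Th).
by apply: eq_integral => x _; rewrite -dE.
Qed.
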